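(* Let $k_1,\ldots,k_N$ be (possibly different) positive definite $\mathbb C^{p\times p}$-valued kernels on $B(0,\epsilon)$, with reproducing kernel Hilbert spaces $\mathfrak H(k_n)$ of $\mathbb C^p$-valued functions analytic in $B(0,\epsilon)$, let $K=\mathrm{diag}(k_1,\ldots,k_N)$, and let $$\mathbb K(z,w)=(Z_r(z)\otimes I_p)K(r(z),r(w))(Z_r(w)\otimes I_p)^*,\qquad z,w\in r^{-1}(B(0,\epsilon)).$$ Every $f\in\mathfrak H(\mathbb K)$ has a unique decomposition $f(z)=\sum_{n=1}^Ne_n(z)F_n(r(z))$ with $F_n\in\mathfrak H(k_n)$. Then the formulas $$(T_nf)(z)=F_n(z),\qquad n=1,\ldots,N,$$ define bounded operators $T_n\in\mathbf L(\mathfrak H(\mathbb K),\mathfrak H(k_n))$, $n=1,\ldots,N$, with adjoint operators $$(T_n^*g)(z)=e_n(z)g(r(z)),$$ and $T_1^*,\ldots,T_N^*$ satisfy the Cuntz relations, that is, $\sum_{n=1}^NT_n^*T_n=I_{\mathfrak H(\mathbb K)}$, $T_nT_n^*=I_{\mathfrak H(k_n)}$, and $T_nT_m^*=0$ for $n\neq m$.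
   Context: $r=P/Q$ is a rational function, $P,Q$ coprime polynomials, $\deg P\ge\deg Q$, $N=\deg P\geq 1$. $\mathfrak L(r)$ is the $N$-dimensional linear span of the functions $z\mapsto\frac{r(z)-r(a)}{z-a}$, $a$ a point of analyticity of $r$; $e_1,\ldots,e_N$ is a fixed basis of $\mathfrak L(r)$ and $Z_r(z)=(e_1(z)\ \cdots\ e_N(z))$. $\epsilon>0$ and $B(0,\epsilon)$ is the open disk. $\mathfrak H(K)$ denotes the reproducing kernel Hilbert space with reproducing kernel $K$; the space $\mathfrak H(\mathbb K)$ consists of the functions $f(z)=(Z_r(z)\otimes I_p)F(r(z))$ with $F=(F_1^t,\ldots,F_N^t)^t\in\mathfrak H(K)$, with norm $\|f\|_{\mathfrak H(\mathbb K)}=\|F\|_{\mathfrak H(K)}$. *)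

(* Defs.v *)
From HB Require Import structures.
From mathcomp Require Import all_boot all_order all_algebra.
From mathcomp Require Import all_classical all_reals all_analysis.
From mathcomp Require Export complex mxtens sesquilinear spectral.

Set Implicit Arguments.
Unset Strict Implicit.
Unset Printing Implicit Defensive.

Import Order.TTheory GRing.Theory Num.Theory numFieldNormedType.Exports.

Local Open Scope classical_set_scope.
Local Open Scope ring_scope.
Local Open Scope sesquilinear_scope.

Definition disk (C : numClosedFieldType) (eps : C) : set C := ball (0 : C) eps.

Section Kernels.
Variables (C : numClosedFieldType) (p : nat).
Implicit Types (A : set C) (K : C -> C -> 'M[C]_p).

Definition cdot (u v : 'cV[C]_p) : C := (v^t* *m u) ord0 ord0.

Definition posdef_kernel A K : Prop :=
  forall (m : nat) (w : 'I_m -> C) (c : 'I_m -> 'cV[C]_p),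
    (forall i, A (w i)) ->
    0 <= \sum_(i < m) \sum_(j < m) cdot (K (w i) (w j) *m c j) (c i).

(* A Hilbert space of functions A -> C^p with reproducing kernel K. Its elements
   are realised as functions by [rk_fun]; values outside A are irrelevant, and
   [rk_inj] says that an element is determined by its values on A. *)
Record rkhs A K := Rkhs {
  rk_space :> completeNormedModType C;
  rk_dot : {dot rk_space for Num.conj};
  rk_norm : forall f : rk_space, `|f| ^+ 2 = rk_dot f f;
  rk_fun : rk_space -> C -> 'cV[C]_p;
  rk_lin : forall (a : C) (f g : rk_space) (z : C), A z ->
    rk_fun (a *: f + g) z = a *: rk_fun f z + rk_fun g z;
  rk_inj : forall f g : rk_space,
    (forall z, A z -> rk_fun f z = rk_fun g z) -> f = g;
  rk_repro : forall (w : C) (c : 'cV[C]_p), A w ->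
    exists kw : rk_space,
      (forall z, A z -> rk_fun kw z = K z w *m c) /\
      (forall f : rk_space, rk_dot f kw = cdot (rk_fun f w) c)
}.

(* For open A: complex differentiability at every point of A. *)
Definition analytic_on A (f : C -> 'cV[C]_p) : Prop :=
  forall i z, A z -> derivable (fun x : C => f x i ord0 : C) z 1.

End Kernels.

Arguments rk_dot {C p A K} r : rename.

Definition bounded_operator (C : numClosedFieldType) (V W : normedModType C)
    (T : V -> W) : Prop :=
  exists M : C, forall f : V, `|T f| <= M * `|f|.

Section RationalFunction.
Variables (C : numClosedFieldType) (P Q : {poly C}).

(* Evaluation of r = P/Q. Since x / 0 = 0, this is r only where Q does not
   vanish, which is why the domains below require it. *)
Definition ratf (z : C) : C := P.[z] / Q.[z].

Definition regular_set : set C := [set z | Q.[z] != 0].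

Definition ratf_preimage (B : set C) : set C :=
  [set z | regular_set z /\ B (ratf z)].

(* z |-> (r(z) - r(a)) / (z - a), with its removable singularity at a filled. *)
Definition diff_quot (a z : C) : C :=
  if z == a then derive1 ratf a else (ratf z - ratf a) / (z - a).

(* Membership in L(r); functions are compared on the points of analyticity. *)
Definition in_Lr (f : C -> C) : Prop :=
  exists (m : nat) (a c : 'I_m -> C),
    (forall i, regular_set (a i)) /\
    (forall z, regular_set z -> f z = \sum_(i < m) c i * diff_quot (a i) z).

Definition basis_Lr (N : nat) (e : 'I_N -> C -> C) : Prop :=
  [/\ forall n, in_Lr (e n),
      forall f, in_Lr f -> exists c : 'I_N -> C,
        forall z, regular_set z -> f z = \sum_(n < N) c n * e n z
    & forall c : 'I_N -> C,
        (forall z, regular_set z -> \sum_(n < N) c n * e n z = 0) ->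
        forall n, c n = 0].

Variables (N p : nat) (e : 'I_N -> C -> C).

Definition Zr (z : C) : 'rV[C]_N := \row_n e n z.

(* The cast only identifies C^(1 * p) with C^p. *)
Definition Zr_tens (z : C) : 'M[C]_(p, N * p) :=
  castmx (mul1n p, erefl (N * p)%N) (Zr z *t (1%:M : 'M[C]_p)).

(* Block diagonal, in the block ordering of the Kronecker product. *)
Definition diag_kernel (k : 'I_N -> C -> C -> 'M[C]_p) (z w : C) :
    'M[C]_(N * p) :=
  \sum_(n < N) (delta_mx n n : 'M[C]_N) *t k n z w.

Definition big_kernel (K : C -> C -> 'M[C]_(N * p)) (z w : C) : 'M[C]_p :=
  Zr_tens z *m K (ratf z) (ratf w) *m (Zr_tens w)^t*.

End RationalFunction.

(* Main.v *)
Require Import Defs.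
From HB Require Import structures.
From mathcomp Require Import all_boot all_order all_algebra.
From mathcomp Require Import all_classical all_reals all_analysis.
From mathcomp Require Import separable ring.
Import Order.TTheory GRing.Theory Num.Theory numFieldNormedType.Exports.
Local Open Scope classical_set_scope.
Local Open Scope ring_scope.

(** Write B for the disk and A for its preimage under r.  The kernel of HK is
    the sum over n of e_n(z) conj(e_n(w)) k_n(r(z), r(w)), so the operators
    S_n g = e_n * (g o r) should be isometries from H_n to HK with orthogonal
    ranges that together fill HK; the theorem says so with T_n = S_n^*.

    Construction of S_n.  A pair (x, y), with x in HK and y in the product of
    the H_m, is called admissible when x decomposes as the sum of the
    e_m * (y_m o r) and <f, x> is the sum of the <F_m, y_m> for every f in HK
    with a decomposition F.  Admissible pairs form a linear relation, satisfy
    |x|^2 = sum |y_m|^2 (take f = x), and include, for every kernel function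
    K_w c, the pair made of K_w c and the conj(e_m(w)) k_m(., r(w)) c.  For g in
    H_n, the functional x |-> <y_n, g> on them is therefore bounded by |g|; a
    vector representing it must take the value e_n(w) g(r(w)) at w
    ([adjoint_exists]).  Hence S_n exists and is a contraction, and T_n is its
    adjoint ([hilbert_adjoint]).  Both steps rest on one form of the Riesz
    theorem for linear relations ([riesz_relation]), proved by minimising
    |x|^2 - 2 Re c over the relation.

    Resolution of the identity.  T_n sends K_w c to conj(e_n(w)) k_n(., r(w)) c,
    so the sum of the S_n T_n fixes every kernel function; it is self-adjoint,
    so it is the identity ([resolution_of_identity]).  In particular the T_n f
    decompose f.

    Uniqueness.  For all but finitely many s, the equation r(z) = s has N
    distinct solutions ([generic_fibre]).  Every e_n is q_n / Q with deg q_n < N,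
    so a combination of the e_n that vanishes at these N points vanishes
    everywhere, and its coefficients are zero by linear independence
    ([fibre_interpolation]).  Thus the difference of two decompositions of f
    vanishes off a finite subset of B, and by continuity on all of B
    ([fibre_uniqueness]).

    The remaining Cuntz relations follow: S_m g has the decomposition with g in
    position m and 0 elsewhere, and also the decomposition by the T_n (S_m g). *)

Set Implicit Arguments.
Unset Strict Implicit.

(** * Minimising sequences in a Hilbert space *)

Section Hilbert.
Context (C : numClosedFieldType) (X : completeNormedModType C).
Context (dot : {dot X for Num.conj}).
Hypothesis dotE : forall x : X, `|x| ^+ 2 = dot x x.

Lemma dot_conj x y : dot y x = (dot x y)^*.
Proof. by rewrite hermC expr0 mul1r. Qed.

Lemma dotZl a x y : dot (a *: x) y = a * dot x y.
Proof. exact: linearZl_LR. Qed.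

Lemma dotZr a x y : dot x (a *: y) = a^* * dot x y.
Proof. by rewrite linearZr_LR. Qed.

Lemma dotDl x y z : dot (x + y) z = dot x z + dot y z.
Proof. exact: linearDl. Qed.

Lemma dotDr x y z : dot x (y + z) = dot x y + dot x z.
Proof. exact: linearDr. Qed.

Lemma dot0l x : dot 0 x = 0.
Proof. exact: linear0l. Qed.

Lemma dot0r x : dot x 0 = 0.
Proof. exact: linear0r. Qed.

Lemma dot_suml n (u : 'I_n -> X) x : dot (\sum_i u i) x = \sum_i dot (u i) x.
Proof. by elim/big_ind2: _ => [|? ? ? ? <- <-|//]; rewrite ?dot0l ?dotDl. Qed.

Lemma dot_sumr n (u : 'I_n -> X) x : dot x (\sum_i u i) = \sum_i dot x (u i).
Proof. by elim/big_ind2: _ => [|? ? ? ? <- <-|//]; rewrite ?dot0r ?dotDr. Qed.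

(** This is the nonnegativity of the squared norm of <y, y> x - <x, y> y. *)
Lemma cauchy_schwarz (x y : X) : `|dot x y| <= `|x| * `|y|.
Proof.
have [->|y0] := eqVneq y 0; first by rewrite linear0r !normr0 mulr0.
have y_gt0 : 0 < dot y y by rewrite dnorm_gt0.
rewrite -(@ler_pXn2r _ 2) ?nnegrE ?mulr_ge0// exprMn !dotE.
have := dnorm_ge0 dot (dot y y *: x - dot x y *: y).
rewrite dnormB !(dotZl, dotZr).
rewrite !rmorphM/= !conjCK normCK -!dot_conj.
set d := dot x y; set d' := dot y x; set b := dot y y; set a := dot x x.
have -> : b * (b * a) + d * (d' * b) - (b * (d' * d) + b * (d * d'))
  = b * (a * b - d * d') by ring.
by rewrite pmulr_rge0// subr_ge0.
Qed.

(** This is |x|^2 - 2 Re c: when c is the value at x of a functional represented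
    by h, it equals |x - h|^2 - |h|^2 and is least for x = h. *)
Definition energy (x : X) (c : C) : C := dot x x - (c + c^*).

Section Energy.
Context (G : X -> C -> Prop) (d : C).
Hypothesis G0 : G 0 0.
Hypothesis Glin : forall a x c y e, G x c -> G y e -> G (a *: x + y) (a * c + e).
Hypothesis d_min : forall x c, G x c -> d <= energy x c.

(** Parallelogram law: the midpoint of two almost minimal pairs again has
    energy at least d, which forces x and y to be close. *)
Lemma near_min_dist x c y e s t : G x c -> G y e ->
  energy x c <= d + s -> energy y e <= d + t ->
  `|x - y| ^+ 2 <= (s + t) *+ 2.
Proof.
move=> Gx Gy xs yt.
have Gm : G (2^-1 *: x + (2^-1 *: y + 0)) (2^-1 * c + (2^-1 * e + 0)).
  by do 2![apply: Glin => //].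
have := d_min Gm; rewrite !addr0 => dm.
have -> : `|x - y| ^+ 2 = energy x c *+ 2 + energy y e *+ 2
   - energy (2^-1 *: x + 2^-1 *: y) (2^-1 * c + 2^-1 * e) *+ 4.
  rewrite dotE /energy dnormB dnormD !(dotZl, dotZr).
  rewrite !rmorphD !rmorphM/=.
  have -> : (2^-1 : C)^* = 2^-1 by rewrite fmorphV rmorph_nat.
  by field.
rewrite lerBlDr (le_trans (lerD (ler_wMn2r 2 xs) (ler_wMn2r 2 yt)))//.
have -> : (d + s) *+ 2 + (d + t) *+ 2 = (s + t) *+ 2 + d *+ 4 by ring.
by rewrite lerD2l ler_wMn2r.
Qed.

(** First variation: at an almost minimal pair, moving by a multiple of y
    cannot lower the energy by more than s, so the derivative <y, x> - e of
    the energy in the direction y is small. *)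
Lemma near_min_stationary x c y e s : G x c -> G y e ->
  energy x c <= d + s -> `|dot y x - e| ^+ 2 <= s * (`|y| ^+ 2 + 1).
Proof.
move=> Gx Gy xs.
have [D yx] : {D | dot y x = D + e} by exists (dot y x - e); rewrite subrK.
have [n nE] : {n : C | n = `|y| ^+ 2 + 1} by exists (`|y| ^+ 2 + 1).
rewrite yx addrK -nE.
have n_gt0 : 0 < n by rewrite nE ltr_wpDl ?exprn_ge0.
have nr : n^* = n by rewrite conj_Creal ?gtr0_real.
(* The best step along y is -D^* / |y|^2; adding 1 to the denominator covers
   y = 0 at the cost of a constant factor. *)
have := d_min (Glin (- n^-1 * D^*) Gy Gx).
have -> : energy (- n^-1 * D^* *: y + x) (- n^-1 * D^* * e + c) =
   energy x c - n^-1 * `|D| ^+ 2 - (n^-1) ^+ 2 * `|D| ^+ 2.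
  rewrite /energy dnormD !(dotZl, dotZr) yx !rmorphD !rmorphM/= !rmorphN/=.
  rewrite fmorphV/= nr conjCK -dotE normCK.
  have -> : `|y| ^+ 2 = n - 1 by rewrite nE addrK.
  by field; rewrite gt_eqF.
move=> le1.
rewrite -ler_pdivrMr// mulrC.
have := le_trans le1 (lerB (lerB xs (lexx _)) (_ : 0 <= (n^-1) ^+ 2 * `|D| ^+ 2)).
rewrite subr0 -addrA lerDl subr_ge0; apply.
by rewrite mulr_ge0// exprn_ge0// invr_ge0 ltW.
Qed.

(** A minimising sequence is Cauchy by [near_min_dist], and its limit
    represents G by [near_min_stationary]. *)
Lemma energy_min_representer (u : nat -> X) (c s : nat -> C) :
  (forall n, G (u n) (c n)) -> (forall n, energy (u n) (c n) <= d + s n) ->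
  (forall t, 0 < t -> \forall n \near \oo, s n <= t) ->
  exists2 h, u @ \oo --> h & forall y e, G y e -> dot y h = e.
Proof.
move=> Gu us s0.
have : cauchy (u @ \oo).
  apply: cauchy_exP => t t0.
  have t8 : 0 < t ^+ 2 / 8 by rewrite divr_gt0 ?exprn_gt0.
  have [n0 _ sn] := s0 _ t8.
  exists (u n0); exists n0 => // n /= n0n; rewrite -ball_normE/=.
  rewrite -(@ltr_pXn2r _ 2) ?nnegrE// ?ltW//.
  apply: le_lt_trans (near_min_dist (Gu n0) (Gu n) (us n0) (us n)) _.
  apply: (@le_lt_trans _ _ (t ^+ 2 / 2)).
    have -> : t ^+ 2 / 2 = (t ^+ 2 / 8 + t ^+ 2 / 8) *+ 2 by field.
    by rewrite lerMn2r lerD// sn//=.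
  by rewrite ltr_pdivrMr// ltr_pMr ?exprn_gt0// ltr1n.
move/cauchy_cvg => /cvg_ex [h uh].
exists h => // y e Gy; apply/eqP; rewrite -subr_eq0 -normr_le0.
apply/ler_addgt0Pl => t t0; rewrite addr0.
set n := `|y| + 1.
have n_gt0 : 0 < n by rewrite ltr_wpDl.
have m_gt0 : 0 < `|y| ^+ 2 + 1 by rewrite ltr_wpDl ?exprn_ge0.
pose r := t / n.
have r0 : 0 < r by rewrite divr_gt0.
have /cvgrPdist_le/(_ r r0) hr := uh.
have r2 : 0 < r ^+ 2 / (`|y| ^+ 2 + 1) by rewrite divr_gt0// exprn_gt0.
have sk := s0 _ r2.
near \oo => k.
have -> : dot y h - e = dot y (h - u k) + (dot y (u k) - e).
  by rewrite linearBr/= addrA subrK.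
have -> : t = `|y| * r + r.
  by rewrite -[X in _ + X]mul1r -mulrDl /r mulrC divfK// gt_eqF.
rewrite (le_trans (ler_normD _ _))// lerD//.
  apply: le_trans (cauchy_schwarz _ _) _; apply: ler_wpM2l => //.
  by near: k; exact: hr.
rewrite -(@ler_pXn2r _ 2) ?nnegrE ?(ltW r0)//.
apply: le_trans (near_min_stationary (Gu k) Gy (us k)) _.
rewrite -ler_pdivlMr//.
by near: k; exact: sk.
Unshelve. all: by end_near. Qed.

End Energy.
End Hilbert.

Lemma dot_injl (C : numClosedFieldType) (X : lmodType C)
    (dot : {dot X for Num.conj}) (x y : X) :
  (forall z, dot x z = dot y z) -> x = y.
Proof.
move=> xy; apply/eqP; rewrite -subr_eq0 -(dnorm_eq0 dot).
by rewrite linearBl /= xy subrr.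
Qed.

Lemma linear_bundle (K : pzRingType) (U V : lmodType K) (f : U -> V) :
  linear f -> {g : {linear U -> V} | g =1 f}.
Proof.
move=> flin; pose m := GRing.isLinear.Build K U V _ f flin.
pose g : {linear U -> V} := HB.pack f m.
by exists g.
Qed.

(** * Riesz representation and adjoints *)

Section Complex.
Context (R : realType).
Local Notation C := R[i].

Lemma real_of_gt0 (e : C) : 0 < e -> exists2 r : R, 0 < r & e = (r%:C)%C.
Proof.
move=> e0; exists (complex.Re e); last by rewrite RRe_real ?gtr0_real.
by rewrite -ltcR RRe_real ?gtr0_real.
Qed.

(** The order of R[i] is partial, but elements above a real b are real, so
    the infimum can be taken in R. *)
Lemma complex_inf (E : set C) (b : C) : E !=set0 ->
  b \is Num.real -> (forall z, E z -> b <= z) ->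
  exists d : C, (forall z, E z -> d <= z) /\
    forall t, 0 < t -> exists2 z, E z & z < d + t.
Proof.
move=> [z0 Ez0] breal bE.
have Ereal z : E z -> z = ((complex.Re z)%:C)%C.
  by move=> /bE bz; rewrite RRe_real// -(ler_real bz).
pose S := [set complex.Re z | z in E].
have Sinf : has_inf S.
  split; first by exists (complex.Re z0), z0.
  exists (complex.Re b) => _ [z Ez <-].
  by rewrite -lecR -(Ereal z Ez) RRe_real// bE.
exists ((inf S)%:C)%C; split=> [z Ez|t /real_of_gt0[r r0 ->]].
  rewrite (Ereal z Ez) lecR; apply: ge_inf; first by case: Sinf.
  by exists z.
have [_ [z Ez <-] zlt] := inf_adherent r0 Sinf.
by exists z => //; rewrite (Ereal z Ez) -rmorphD ltcR.
Qed.

Lemma near_inv_le (t : C) : 0 < t -> \forall n \near \oo, (n.+1%:R^-1 : C) <= t.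
Proof.
move=> /real_of_gt0[r r0 ->].
have := near_infty_natSinv_lt (PosNum r0).
apply: filterS => n /= /ltW nr.
by rewrite -[n.+1%:R](rmorph_nat (real_complex R)) -fmorphV lecR.
Qed.

(** A functional is given by its graph G, a linear relation, rather than as a
    function on a subspace: a functional specified on spanning vectors then
    needs no separate proof that it is well defined. *)
Lemma riesz_relation (X : completeNormedModType C) (dot : {dot X for Num.conj})
  (dotE : forall x : X, `|x| ^+ 2 = dot x x) (G : X -> C -> Prop) (M : C) :
  0 <= M -> G 0 0 ->
  (forall a x c y e, G x c -> G y e -> G (a *: x + y) (a * c + e)) ->
  (forall x c, G x c -> `|c| <= M * `|x|) ->
  exists2 h, `|h| <= M & forall x c, G x c -> dot x h = c.
Proof.
move=> M0 G0 Glin GM.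
have conj_le c : c + c^* <= `|c| *+ 2.
  have cr : c + c^* \is Num.real.
    by rewrite CrealE rmorphD/= conjCK addrC.
  rewrite (le_trans (real_ler_norm cr))// (le_trans (ler_normD _ _))//.
  by rewrite norm_conjC mulr2n.
have energy_ge x c : G x c -> - M ^+ 2 <= energy dot x c.
  move=> Gxc; rewrite -subr_ge0 /energy -dotE.
  have -> : `|x| ^+ 2 - (c + c^*) - (- M ^+ 2) = (`|x| - M) ^+ 2
    + (M * `|x| - `|c|) *+ 2 + (`|c| *+ 2 - (c + c^*)) by ring.
  rewrite addr_ge0 ?subr_ge0// ?conj_le// addr_ge0//.
    by rewrite real_exprn_even_ge0// rpredB// ger0_real.
  by rewrite mulrn_wge0// subr_ge0 GM.
have [||_ [[x c] Gxc <-]|d [dle dlt]] := @complex_inf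
    [set energy dot xc.1 xc.2 | xc in [set xc : X * C | G xc.1 xc.2]] (- M ^+ 2).
- by exists (energy dot 0 0), (0, 0).
- by rewrite rpredN rpredX// ger0_real.
- exact: energy_ge.
have /choice[u uP] n : exists xc : X * C,
    G xc.1 xc.2 /\ energy dot xc.1 xc.2 <= d + n.+1%:R^-1.
  have [|_ [xc Gxc <-] /ltW xclt] := dlt n.+1%:R^-1; last by exists xc.
  by rewrite invr_gt0.
have [|h uh hP] := energy_min_representer dotE G0 Glin
    (fun x c Gxc => dle _ (ex_intro2 _ _ (x, c) Gxc erefl))
    (fun n => (uP n).1) (fun n => (uP n).2).
  exact: near_inv_le.
exists h => //.
(* |h|^2 is the limit of <u n, h> = c n, of modulus at most M |u n|. *)
have [->|h0] := eqVneq h 0; first by rewrite normr0.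
have h_gt0 : 0 < `|h| by rewrite normr_gt0.
rewrite -(ler_pM2r h_gt0); apply/ler_addgt0Pl => t t0.
have K0 : 0 < `|h| + M by rewrite ltr_pwDl.
have r0 : 0 < t / (`|h| + M) by rewrite divr_gt0.
have /cvgrPdist_le/(_ _ r0) hr := uh.
near \oo => n.
have hn : `|h - (u n).1| <= t / (`|h| + M) by near: n; exact: hr.
have un : `|(u n).1| <= t / (`|h| + M) + `|h|.
  rewrite -[(u n).1](subrK h) (le_trans (ler_normD _ _))// lerD2r.
  by rewrite distrC.
have -> : t = t / (`|h| + M) * `|h| + M * (t / (`|h| + M)).
  by field; rewrite gt_eqF.
rewrite -expr2 dotE -(ger0_norm (dnorm_ge0 dot h)).
have -> : dot h h = dot (h - (u n).1) h + dot (u n).1 h.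
  by rewrite -linearDl subrK.
rewrite -addrA (le_trans (ler_normD _ _))// lerD//.
  by rewrite (le_trans (cauchy_schwarz dotE _ _))// ler_wpM2r.
rewrite (hP _ _ (uP n).1) (le_trans (GM _ _ (uP n).1))//.
by rewrite -mulrDr ler_wpM2l.
Unshelve. all: by end_near. Qed.

Lemma hilbert_adjoint (X Y : completeNormedModType C)
    (dX : {dot X for Num.conj}) (dY : {dot Y for Num.conj})
    (dXE : forall x, `|x| ^+ 2 = dX x x) (dYE : forall y, `|y| ^+ 2 = dY y y)
    (S : {linear X -> Y}) (S_le : forall x, `|S x| <= `|x|) :
  {T : {linear Y -> X} | (forall y, `|T y| <= `|y|) /\
    forall y x, dX (T y) x = dY y (S x)}.
Proof.
have T_ex (y : Y) : exists t, `|t| <= `|y| /\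
    forall x, dX t x = dY y (S x).
  have [|a x c x' c' -> ->|x c ->|h hy hE] :=
    riesz_relation dXE (G := fun x c => c = dY (S x) y) (normr_ge0 y).
  - by rewrite linear0 dot0l.
  - by rewrite linearP dotDl dotZl.
  - rewrite (le_trans (cauchy_schwarz dYE _ _))// mulrC ler_wpM2l//.
  - exists h; split=> // x.
    by rewrite dot_conj (hE _ _ erefl) -dot_conj.
have [T TP] := choice T_ex.
have Tlin : linear T.
  move=> a y y'; apply: (@dot_injl _ _ dX) => x.
  by rewrite dotDl dotZl !(TP _).2 dotDl dotZl.
have [T' T'E] := linear_bundle Tlin.
by exists T'; split=> y; rewrite T'E; case: (TP y).
Qed.

End Complex.

(** * Spaces with a reproducing kernel *)

Section Rkhs.
Context (C : numClosedFieldType) (p : nat).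

Lemma cdotE (u v : 'cV[C]_p) : cdot u v = \sum_i (v i ord0)^* * u i ord0.
Proof. by rewrite /cdot mxE; apply: eq_bigr => i _; rewrite !mxE. Qed.

Lemma cdotZ a (u v : 'cV[C]_p) : cdot (a *: u) v = a * cdot u v.
Proof. by rewrite /cdot -scalemxAr mxE. Qed.

Lemma cdot_sum n (u : 'I_n -> 'cV[C]_p) (v : 'cV[C]_p) :
  cdot (\sum_i u i) v = \sum_i cdot (u i) v.
Proof. by rewrite /cdot mulmx_sumr summxE. Qed.

Lemma cdot_inj (u v : 'cV[C]_p) : (forall c, cdot u c = cdot v c) -> u = v.
Proof.
move=> uv; apply/matrixP => i j; rewrite ord1.
have cdot_delta (w : 'cV[C]_p) : cdot w (delta_mx i ord0) = w i ord0.
  rewrite cdotE (bigD1 i)//= big1 ?addr0 => [|l /negPf li].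
    by rewrite mxE !eqxx conjC1 mul1r.
  by rewrite mxE li conjC0 mul0r.
by rewrite -!cdot_delta uv.
Qed.

Context (A : set C) (K : C -> C -> 'M[C]_p) (H : rkhs A K).

Lemma rk_fun0 z : A z -> rk_fun (0 : H) z = 0.
Proof.
move=> Az; have := rk_lin 1 (0 : H) 0 Az.
by rewrite !scale1r addr0 -{1}[rk_fun _ z]addr0 => /addrI.
Qed.

Lemma rk_funD (f g : H) z : A z -> rk_fun (f + g) z = rk_fun f z + rk_fun g z.
Proof. by move=> Az; rewrite -{1}[f]scale1r rk_lin// scale1r. Qed.

Lemma rk_funZ a (f : H) z : A z -> rk_fun (a *: f) z = a *: rk_fun f z.
Proof. by move=> Az; rewrite -[a *: f]addr0 rk_lin// rk_fun0// addr0. Qed.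

Lemma rk_fun_sum n (f : 'I_n -> H) z : A z ->
  rk_fun (\sum_i f i) z = \sum_i rk_fun (f i) z.
Proof.
move=> Az; elim/big_ind2: _ => // [|f1 u1 f2 u2 <- <-]; first exact: rk_fun0.
exact: rk_funD.
Qed.

End Rkhs.

(** * Weighted composition operators *)

Section WeightedComposition.
Context (R : realType).
Local Notation C := R[i].
Context (N p : nat) (A B : set C) (r : C -> C) (e : 'I_N -> C -> C).
Context (k : 'I_N -> C -> C -> 'M[C]_p) (K : C -> C -> 'M[C]_p).
Context (H : forall n, rkhs B (k n)) (HK : rkhs A K).
Hypothesis rAB : forall z, A z -> B (r z).
Hypothesis kernelE : forall z w (c : 'cV[C]_p), A z -> A w ->
  K z w *m c = \sum_n (e n z * (e n w)^*) *: (k n (r z) (r w) *m c).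

Definition decomposition (f : HK) (F : forall n, H n) : Prop :=
  forall z, A z -> rk_fun f z = \sum_n e n z *: rk_fun (F n) (r z).

(** The components conj(e_n(w)) k_n(., r(w)) c can be read off from the formula
    for K; they reproduce values at r(w) as kw does at w, so inner products
    with kw and with its components can be compared term by term. *)
Lemma kernel_decomposition w c : A w ->
  exists (kw : HK) (y : forall n, H n),
    [/\ decomposition kw y,
      forall f, rk_dot HK f kw = cdot (rk_fun f w) c &
      forall n F, rk_dot (H n) F (y n) = e n w * cdot (rk_fun F (r w)) c].
Proof.
move=> Aw; have [kw [kwE kw_dot]] := rk_repro HK c Aw.
have [y yP] : exists y : forall n, H n, forall n,
    (forall z, B z -> rk_fun (y n) z = k n z (r w) *m c) /\
    (forall F, rk_dot (H n) F (y n) = cdot (rk_fun F (r w)) c).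
  pose yP n := cid (rk_repro (H n) c (rAB Aw)).
  by exists (fun n => projT1 (yP n)) => n; exact: (projT2 (yP n)).
exists kw, (fun n => (e n w)^* *: y n); split=> // [z Az|n F].
  rewrite kwE// kernelE//; apply: eq_bigr => n _.
  by rewrite rk_funZ ?(yP n).1 ?scalerA//; exact: rAB.
by rewrite dotZr conjCK (yP n).2.
Qed.

(** Riesz representation of the functional x |-> <y_n, g>, where y ranges over
    the decompositions of x that are compatible with all inner products. *)
Lemma adjoint_exists n (g : H n) :
  exists2 h : HK, `|h| <= `|g| &
    forall z, A z -> rk_fun h z = e n z *: rk_fun g (r z).
Proof.
pose G (x : HK) (c : C) := exists y : forall m, H m,
  [/\ decomposition x y,
    forall f F, decomposition f F ->
      rk_dot HK f x = \sum_m rk_dot (H m) (F m) (y m) &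
    c = rk_dot (H n) (y n) g].
have [||a x c x' c' [y [xy xdot ->]] [y' [xy' xdot' ->]]|x c|h hg hG] :=
    @riesz_relation R HK (rk_dot HK) (@rk_norm _ _ _ _ HK) G `|g| => //.
- exists (fun m => 0); split.
  + move=> z Az; rewrite rk_fun0// big1// => m _.
    by rewrite rk_fun0 ?scaler0//; exact: rAB.
  + by move=> f F _; rewrite dot0r big1// => m _; rewrite dot0r.
  + by rewrite dot0l.
- exists (fun m => a *: y m + y' m); split.
  + move=> z Az; rewrite rk_lin// xy// xy'// scaler_sumr -big_split/=.
    apply: eq_bigr => m _; rewrite rk_lin; last exact: rAB.
    by rewrite scalerDr !scalerA mulrC.
  + move=> f F fF; rewrite dotDr dotZr (xdot _ _ fF) (xdot' _ _ fF) mulr_sumr.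
    by rewrite -big_split/=; apply: eq_bigr => m _; rewrite dotDr dotZr.
  + by rewrite dotDl dotZl.
- move=> [y [xy xdot ->]].
  apply: le_trans (cauchy_schwarz (@rk_norm _ _ _ _ _) _ _) _.
  rewrite mulrC ler_wpM2l// -(@ler_pXn2r _ 2) ?nnegrE// !rk_norm.
  rewrite (xdot _ _ xy) (bigD1 n)//= lerDl sumr_ge0//.
exists h => // w Aw; apply: cdot_inj => c.
have [kw [y [kwy kw_dot y_dot]]] := kernel_decomposition c Aw.
rewrite cdotZ -kw_dot -y_dot dot_conj [RHS]dot_conj; congr (_ ^*).
apply: hG; exists y; split=> // f F fF.
rewrite kw_dot fF// cdot_sum; apply: eq_bigr => m _.
by rewrite cdotZ y_dot.
Qed.

Lemma adjoint_operator : exists S : forall n, {linear H n -> HK},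
  forall n g, `|S n g| <= `|g| /\
    forall z, A z -> rk_fun (S n g) z = e n z *: rk_fun g (r z).
Proof.
suff Sn n : {S : {linear H n -> HK} | forall g, `|S g| <= `|g| /\
    forall z, A z -> rk_fun (S g) z = e n z *: rk_fun g (r z)}.
  by exists (fun n => projT1 (Sn n)) => n; exact: (projT2 (Sn n)).
have S_ex (g : H n) : exists h : HK, `|h| <= `|g| /\
    forall z, A z -> rk_fun h z = e n z *: rk_fun g (r z).
  by have [h hg hE] := adjoint_exists g; exists h.
have [S SP] := choice S_ex.
have Slin : linear S.
  move=> a f g; apply: rk_inj => z Az.
  rewrite rk_lin// !(SP _).2// rk_lin; last exact: rAB.
  by rewrite scalerDr !scalerA mulrC.
have [S' S'E] := linear_bundle Slin.
by exists S' => g; rewrite S'E; exact: SP.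
Qed.

(** The left-hand side is a self-adjoint operator that fixes the kernel
    functions, and inner products with these separate points. *)
Lemma resolution_of_identity (S : forall n, {linear H n -> HK})
    (T : forall n, {linear HK -> H n})
    (SE : forall n g z, A z -> rk_fun (S n g) z = e n z *: rk_fun g (r z))
    (TS : forall n f g, rk_dot (H n) (T n f) g = rk_dot HK f (S n g)) f :
  \sum_n S n (T n f) = f.
Proof.
apply: rk_inj => w Aw; apply: cdot_inj => c.
have [kw [y [kwy kw_dot y_dot]]] := kernel_decomposition c Aw.
have Tkw n : T n kw = y n.
  apply: (@dot_injl _ _ (rk_dot (H n))) => g.
  rewrite TS dot_conj [RHS]dot_conj; congr (_ ^*).
  by rewrite kw_dot SE// cdotZ y_dot.
have Sy : \sum_n S n (y n) = kw.
  apply: rk_inj => z Az; rewrite rk_fun_sum// kwy//.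
  by apply: eq_bigr => n _; rewrite SE.
rewrite -!kw_dot dot_suml -[in RHS]Sy dot_sumr; apply: eq_bigr => n _ /=.
by rewrite dot_conj -TS Tkw -dot_conj TS.
Qed.

End WeightedComposition.

(** * Generic fibres of a rational function *)

Section Fibres.
Context (C : numClosedFieldType).

Lemma continuous_poly (p : {poly C}) : continuous (fun x : C => p.[x] : C).
Proof.
elim/poly_ind: p => [|p c IHp].
  have -> : (fun x : C => (0 : {poly C}).[x] : C) = cst (0 : C).
    by apply/funext => x; rewrite horner0.
  exact: cst_continuous.
have -> : (fun x : C => (p * 'X + c%:P).[x] : C) =
    (fun x : C => (p.[x] : C) * x + c).
  by apply/funext => x; rewrite hornerMXaddC.
move=> a; have ap : {for a, continuous (fun x : C => (p.[x] : C) * x)}.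
  by apply: continuousM; [exact: IHp|exact: cvg_id].
by apply: continuousD ap _; exact: (@cst_continuous _ C c).
Qed.

Lemma near_notin (s : C) (bad : seq C) : \forall t \near s^', t \notin bad.
Proof.
elim: bad => [|b bad IH]; first by apply: nearW.
suff bt : \forall t \near s^', t != b.
  by apply: filterS2 bt IH => t tb tbad; rewrite inE negb_or tb.
have [<-|sb] := eqVneq s b; first exact: nbhs_dnbhs_neq.
have sb0 : 0 < `|s - b| by rewrite normr_gt0 subr_eq0.
apply: nbhs_dnbhs; apply/nbhs_ballP; exists `|s - b| => // t.
by rewrite -ball_normE /=; apply: contraTneq => ->; rewrite ltxx.
Qed.

Context (P Q : {poly C}).
Hypothesis PQ : coprimep P Q.

(** The Bezout quotient (Q(a) P(x) - P(a) Q(x)) / (x - a), which up to the factor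
    Q(a) Q(x) is the difference quotient of P/Q. *)
Definition quot_poly a := (Q.[a] *: P - P.[a] *: Q) %/ ('X - a%:P).

Lemma quot_polyE a : Q.[a] *: P - P.[a] *: Q = quot_poly a * ('X - a%:P).
Proof.
apply/esym/divpK; rewrite dvdp_XsubCl rootE hornerD hornerN !hornerZ.
by rewrite mulrC subrr.
Qed.

Lemma quot_poly_ratf a x : Q.[a] != 0 -> Q.[x] != 0 -> x != a ->
  (ratf P Q x - ratf P Q a) / (x - a) = (quot_poly a).[x] / Q.[a] / Q.[x].
Proof.
move=> Qa Qx; rewrite -subr_eq0 => xa.
have := congr1 (horner^~ x) (quot_polyE a).
rewrite hornerM !hornerE /= => /(congr1 (fun y => y / (x - a))).
rewrite mulfK// => <-.
by rewrite /ratf; field; rewrite xa Qa Qx.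
Qed.

(** The difference quotients of r are those of [quot_poly_ratf] off a, and the
    right-hand side there is continuous at a. *)
Lemma derive1_ratf a : Q.[a] != 0 ->
  derive1 (ratf P Q) a = (quot_poly a).[a] / Q.[a] / Q.[a].
Proof.
move=> Qa; apply: cvg_lim; first exact: norm_hausdorff.
have shift_cvg : h + a @[h --> (0 : C)^'] --> a.
  rewrite -[X in _ --> X]add0r; apply: cvgD; last exact: cvg_cst.
  exact: nbhs_dnbhs.
have horner_cvg p : (p.[h + a] : C) @[h --> (0 : C)^'] --> (p.[a] : C).
  exact: (cvg_comp _ _ shift_cvg (@continuous_poly p a)).
apply: cvg_trans (cvgM (cvgM (horner_cvg (quot_poly a))
   (cvg_cst (Q.[a]^-1 : C))) (cvgV Qa (horner_cvg Q))).
apply: near_eq_cvg.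
near=> h.
have h0 : h != 0 by near: h; exact: nbhs_dnbhs_neq.
have Qh : Q.[h + a] != 0 by near: h; exact: cvgr_neq0 (horner_cvg Q) Qa.
have ha : h + a != a by rewrite -subr_eq0 addrK.
have := quot_poly_ratf Qa Qh ha; rewrite addrK => quotE.
by rewrite -[LHS]/((quot_poly a).[h + a] / Q.[a] / Q.[h + a]) -quotE mulrC.
Unshelve. all: by end_near. Qed.

Lemma diff_quotE a z : Q.[a] != 0 -> Q.[z] != 0 ->
  diff_quot P Q a z = (quot_poly a).[z] / Q.[a] / Q.[z].
Proof.
move=> Qa Qz; rewrite /diff_quot; case: eqVneq => [->|za].
  exact: derive1_ratf.
exact: quot_poly_ratf.
Qed.

Context (N : nat).
Hypothesis sP : size P = N.+1.
Hypothesis sQ : (size Q <= N.+1)%N.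

Lemma size_quot_poly a : (size (quot_poly a) <= N)%N.
Proof.
have [->|q0] := eqVneq (quot_poly a) 0; first by rewrite size_poly0.
have := size_Mmonic q0 (monicXsubC a).
rewrite size_XsubC addn2 -quot_polyE /= -ltnS => <-.
rewrite (leq_trans (size_polyD _ _))// geq_max size_polyN.
by rewrite !(leq_trans (size_scale_leq _ _)) ?sP.
Qed.

Lemma in_Lr_poly f : in_Lr P Q f ->
  exists2 q : {poly C}, (size q <= N)%N &
    forall z, regular_set Q z -> f z = q.[z] / Q.[z].
Proof.
move=> [m [a [c [areg fE]]]].
exists (\sum_i (c i / Q.[a i]) *: quot_poly (a i)).
  apply: (leq_trans (size_sum _ _ _)); apply/bigmax_leqP => i _.
  by rewrite (leq_trans (size_scale_leq _ _))// size_quot_poly.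
move=> z zreg; rewrite fE// horner_sum mulr_suml; apply: eq_bigr => i _.
rewrite diff_quotE//; last exact: areg.
by rewrite hornerZ !mulrA; congr (_ / _); rewrite mulrAC.
Qed.

(** The combination is s / Q with size s <= N, and s has the N roots zs. *)
Lemma fibre_interpolation (e : 'I_N -> C -> C) (zs : seq C) (v : 'I_N -> C) :
  basis_Lr P Q e -> uniq zs -> size zs = N ->
  (forall z, z \in zs -> regular_set Q z) ->
  (forall z, z \in zs -> \sum_n v n * e n z = 0) -> forall n, v n = 0.
Proof.
move=> [eL _ efree] uzs szs zreg vz; apply: efree.
have /choice[q qP] n : exists q : {poly C}, (size q <= N)%N /\
    forall z, regular_set Q z -> e n z = q.[z] / Q.[z].
  by have [q] := in_Lr_poly (eL n); exists q.
pose s := \sum_n v n *: q n.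
have sE z : regular_set Q z -> \sum_n v n * e n z = s.[z] / Q.[z].
  move=> zr; rewrite horner_sum mulr_suml; apply: eq_bigr => n _.
  by rewrite (qP n).2// hornerZ mulrA.
suff s0 : s = 0 by move=> z /sE ->; rewrite s0 horner0 mul0r.
apply/eqP/contraT => s_neq0.
have := max_poly_roots s_neq0 _ uzs; rewrite szs ltnNge.
case: (all _ _) / allP => [|[]]; last first.
  move=> z zzs; have := vz z zzs; rewrite (sE z (zreg z zzs)).
  by move/eqP; rewrite mulf_eq0 invr_eq0 (negPf (zreg z zzs)) orbF.
rewrite (leq_trans (size_sum _ _ _)) => [_ /(_ isT)//|].
apply/bigmax_leqP => n _.
by rewrite (leq_trans (size_scale_leq _ _))// (qP n).1.
Qed.

Hypothesis N_gt0 : (0 < N)%N.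

(** Otherwise P would divide P' * Q, hence P' by coprimality, against the degree
    (P' is nonzero in characteristic 0). *)
Lemma wronskian_neq0 : P^`() * Q - P * Q^`() != 0.
Proof.
have P0 : P != 0 by rewrite -size_poly_eq0 sP.
have dP0 : P^`() != 0.
  apply/eqP => dP.
  have := coef_deriv P N.-1; rewrite dP coef0 prednK// => /esym/eqP.
  rewrite mulrn_eq0 -leqn0 leqNgt N_gt0/= => /eqP PN.
  by move: P0; rewrite -lead_coef_eq0 lead_coefE sP /= PN eqxx.
rewrite subr_eq0; apply/eqP => PQE.
have : P %| P^`() * Q by rewrite PQE dvdp_mulr.
rewrite Gauss_dvdpl// => /(dvdp_leq dP0).
by rewrite leqNgt lt_size_deriv.
Qed.

Lemma closed_roots (p : {poly C}) : p != 0 ->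
  exists s : seq C, forall z, root p z -> z \in s.
Proof.
move=> p0; have [s ps] := closed_field_poly_normal p; exists s => z.
by rewrite ps rootZ ?lead_coef_eq0// root_prod_XsubC.
Qed.

(** The excluded values are the value at infinity P_N / Q_N, where the degree of
    P - s Q drops, and the critical values, where P - s Q has a multiple root:
    at such a root P = s Q and P' = s Q', so P' Q - P Q' vanishes. *)
Lemma generic_fibre : exists bad : seq C, forall s, s \notin bad ->
  exists zs : seq C, [/\ uniq zs, size zs = N &
    forall z, z \in zs -> regular_set Q z /\ ratf P Q z = s].
Proof.
have [crit critP] := closed_roots wronskian_neq0.
(* When deg Q < N the first value is P_N / 0 = 0, which excludes one more point. *)
exists (P`_N / Q`_N :: map (ratf P Q) crit) => s.
rewrite inE negb_or => /andP[sN scrit].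
pose D := P - s *: Q.
have PN : P`_N != 0.
  by rewrite -[N]/(N.+1.-1) -sP -lead_coefE lead_coef_eq0 -size_poly_eq0 sP.
have DN : D`_N != 0.
  rewrite coefB coefZ subr_eq0; apply: contra sN => /eqP PsQ.
  by rewrite PsQ mulfK//; apply: contra PN => /eqP QN; rewrite PsQ QN mulr0.
have D0 : D != 0 by apply: contra DN => /eqP ->; rewrite coef0.
have sD : size D = N.+1.
  apply/eqP; rewrite eqn_leq; apply/andP; split.
    rewrite (leq_trans (size_polyD _ _))// geq_max size_polyN sP leqnn.
    by rewrite (leq_trans (size_scale_leq _ _)).
  by rewrite ltnNge; apply: contra DN => /leq_sizeP/(_ N (leqnn N)) ->.
have [zs Dzs] := closed_field_poly_normal D.
have rootD z : (z \in zs) = root D z.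
  by rewrite Dzs rootZ ?lead_coef_eq0// root_prod_XsubC.
have fibre z : z \in zs -> regular_set Q z /\ ratf P Q z = s.
  rewrite rootD rootE hornerD hornerN hornerZ subr_eq0 => /eqP PsQ.
  have Qz : Q.[z] != 0.
    apply/eqP => Qz; have : root P z by rewrite rootE PsQ Qz mulr0.
    by move/(coprimep_root PQ); rewrite Qz eqxx.
  by split=> //; rewrite /ratf PsQ mulfK.
exists zs; split=> //; last first.
  by apply: succn_inj; rewrite -sD Dzs size_scale ?lead_coef_eq0// size_prod_XsubC.
rewrite -separable_prod_XsubC.
have -> : separable_poly (\prod_(x <- zs) ('X - x%:P)) = separable_poly D.
  by rewrite Dzs; apply/esym/eqp_separable/eqp_scale; rewrite lead_coef_eq0.
rewrite unlock; apply: Pdiv.ClosedField.root_coprimep => z Dz.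
apply: contra scrit => /eqP dDz.
have zzs : z \in zs by rewrite rootD.
have [Qz <-] := fibre z zzs.
apply: map_f; apply: critP.
have := Dz; rewrite rootE /D !hornerE => /eqP/subr0_eq PsQ.
move: dDz; rewrite /D derivB derivZ !hornerE => /subr0_eq dPsQ.
by rewrite rootE !hornerE PsQ dPsQ; apply/eqP; ring.
Qed.

(** The v n vanish off the finite set of [generic_fibre] by interpolation on
    the fibres; a punctured neighbourhood of s avoids that set. *)
Lemma fibre_uniqueness (e : 'I_N -> C -> C) (eps : C) (v : 'I_N -> C -> C) :
  basis_Lr P Q e ->
  (forall n s, disk eps s -> {for s, continuous (v n : C -> C)}) ->
  (forall z, ratf_preimage P Q (disk eps) z ->
     \sum_n v n (ratf P Q z) * e n z = 0) ->
  forall n s, disk eps s -> v n s = 0.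
Proof.
move=> he vcont vz n s s_disk.
have [bad badP] := generic_fibre.
have v0 t : t \notin bad -> disk eps t -> v n t = 0.
  move=> /badP[zs [uzs szs zsP]] t_disk.
  apply: (fibre_interpolation (v := v^~ t) he uzs szs) => z zzs.
    exact: (zsP z zzs).1.
  have [zr zt] := zsP z zzs.
  by have := vz z; rewrite zt; apply; split=> //; rewrite zt.
have : v n t @[t --> s^'] --> v n s.
  by apply: cvg_trans (vcont n s s_disk); apply: cvg_app; exact: nbhs_dnbhs.
have : v n t @[t --> s^'] --> (0 : C).
  apply: cvg_near_cst.
  have disk_near : \forall t \near s^', disk eps t.
    by apply: nbhs_dnbhs; apply: open_nbhs_nbhs; split=> //; exact: ball_open.
  by apply: filterS2 (near_notin s bad) disk_near => t; exact: v0.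
by move=> v_0 v_s; apply: cvg_unique v_s v_0; exact: norm_hausdorff.
Qed.

End Fibres.

(** * The block diagonal kernel and the Cuntz relations *)

Section Kernel.
Local Open Scope sesquilinear_scope.

(** Each term is a product of Kronecker products, whose first factor is the
    1 x 1 matrix e_n(z) conj(e_n(w)). *)
Lemma big_kernelE (C : numClosedFieldType) (P Q : {poly C}) (N p : nat)
    (e : 'I_N -> C -> C) (k : 'I_N -> C -> C -> 'M[C]_p) z w (c : 'cV[C]_p) :
  big_kernel P Q e (diag_kernel k) z w *m c =
  \sum_n (e n z * (e n w)^*) *: (k n (ratf P Q z) (ratf P Q w) *m c).
Proof.
have cast_conj m m' (E : m = m') q (X : 'M[C]_(m, q)) :
    (castmx (E, erefl q) X)^t* = castmx (erefl q, E) (X^t*).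
  by case: _ / E; rewrite !castmx_id.
have cast_sandwich m m' (E : m = m') q (X : 'M[C]_(m, q)) D (Y : 'M[C]_(q, m)) :
    castmx (E, erefl q) X *m D *m castmx (erefl q, E) Y =
    castmx (E, E) (X *m D *m Y).
  by case: _ / E; rewrite !castmx_id.
rewrite /big_kernel /diag_kernel mulmx_sumr !mulmx_suml.
apply: eq_bigr => n _; rewrite scalemxAl; congr (_ *m _).
rewrite /Zr_tens cast_conj cast_sandwich trmx_tens map_mxT !tensmx_mul.
rewrite trmx1 map_mx1 mul1mx mulmx1 [X in X *t _]mx11_scalar tens_scalar_mx.
rewrite castmx_comp castmx_id; congr (_ *: _).
rewrite mxE (bigD1 n)//= big1 ?addr0 => [|m /negPf mn].
  rewrite mxE (bigD1 n)//= big1 ?addr0 => [|m /negPf mn].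
    by rewrite !mxE !eqxx mulr1.
  by rewrite !mxE mn mulr0.
rewrite [X in X * _]mxE big1 ?mul0r// => l _.
by rewrite !mxE mn andbF mulr0.
Qed.

End Kernel.

Unset Implicit Arguments.
Set Strict Implicit.

Theorem theorem5p1 (R : realType) (P Q : {poly R[i]}) (N p : nat)
  (hPQ : coprimep P Q) (hdeg : (size Q <= size P)%N)
  (hN : size P = N.+1) (hN1 : (1 <= N)%N)
  (e : 'I_N -> R[i] -> R[i]) (he : basis_Lr P Q e)
  (eps : R) (heps : 0 < eps)
  (k : 'I_N -> R[i] -> R[i] -> 'M[R[i]]_p)
  (hk : forall n, posdef_kernel (disk eps%:C%C) (k n))
  (H : forall n, rkhs (disk eps%:C%C) (k n))
  (hana : forall n (f : H n), analytic_on (disk eps%:C%C) (rk_fun f))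
  (HK : rkhs (ratf_preimage P Q (disk eps%:C%C)) (big_kernel P Q e (diag_kernel k))) :
  let decomposes (f : HK) (F : forall n, H n) :=
    forall z, ratf_preimage P Q (disk eps%:C%C) z ->
      rk_fun f z = \sum_(n < N) e n z *: rk_fun (F n) (ratf P Q z) in
  (forall f : HK, exists! F : forall n, H n, decomposes f F) /\
  exists (T : forall n, {linear HK -> H n}) (Tadj : forall n, {linear H n -> HK}),
    [/\ (forall (f : HK) (F : forall n, H n), decomposes f F ->
           forall n z, disk eps%:C%C z -> rk_fun (T n f) z = rk_fun (F n) z),
        (forall n, bounded_operator (T n) /\ bounded_operator (Tadj n)),
        (forall n (f : HK) (g : H n),
           rk_dot (H n) (T n f) g = rk_dot HK f (Tadj n g)),
        (forall n (g : H n) z, ratf_preimage P Q (disk eps%:C%C) z ->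
           rk_fun (Tadj n g) z = e n z *: rk_fun g (ratf P Q z))
      & [/\ forall f : HK, \sum_(n < N) Tadj n (T n f) = f,
            forall n (g : H n), T n (Tadj n g) = g
          & forall n m (g : H m), n != m -> T n (Tadj m g) = 0]].
Proof.
set B := disk eps%:C%C; set A := ratf_preimage P Q B.
move=> decomposes.
have AB z : A z -> B (ratf P Q z) by case.
have sQ : (size Q <= N.+1)%N by rewrite -hN.
have kernelE z w (c : 'cV[R[i]]_p) (_ : A z) (_ : A w) := big_kernelE P Q e k z w c.
have decomposes_inj f (F F' : forall n, H n) :
    decomposes f F -> decomposes f F' -> F = F'.
  move=> fF fF'; apply: functional_extensionality_dep => n.
  apply: rk_inj => s s_disk; apply/matrixP => i j; rewrite ord1.
  apply/eqP; rewrite -subr_eq0; apply/eqP; move: n s s_disk.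
  apply: (@fibre_uniqueness _ P Q hPQ N hN sQ hN1 e eps%:C%C
    (fun n s => rk_fun (F n) s i ord0 - rk_fun (F' n) s i ord0) he).
    move=> n s s_disk; apply: continuousB.
      exact/differentiable_continuous/derivable1_diffP/hana.
    exact/differentiable_continuous/derivable1_diffP/hana.
  move=> z Az.
  have := fF z Az; rewrite (fF' z Az) => /matrixP/(_ i ord0).
  rewrite !summxE => /eqP; rewrite eq_sym -subr_eq0 -sumrB => /eqP.
  by under eq_bigr do rewrite !mxE -mulrBr mulrC.
have [S SP] := adjoint_operator H HK AB kernelE.
have S_le n g := (SP n g).1; have SE n g := (SP n g).2.
pose adj n := hilbert_adjoint (@rk_norm _ _ _ _ (H n)) (@rk_norm _ _ _ _ HK) (S_le n).
pose T n := projT1 (adj n).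
have T_le n f : `|T n f| <= `|f| := (projT2 (adj n)).1 f.
have TS n f g : rk_dot (H n) (T n f) g = rk_dot HK f (S n g) := (projT2 (adj n)).2 f g.
have ST f : \sum_n S n (T n f) = f := resolution_of_identity AB kernelE SE TS f.
have decomposesT f : decomposes f (fun n => T n f).
  move=> z Az; rewrite -[in LHS](ST f) rk_fun_sum//.
  by apply: eq_bigr => n _; rewrite SE.
have TS_delta m (g : H m) n : T n (S m g) = dfwith (fun n => 0 : H n) m g n.
  suff : decomposes (S m g) (dfwith (fun n => 0 : H n) m g).
    by move=> /(decomposes_inj _ _ _ (decomposesT (S m g)))/(congr1 (fun F => F n)).
  move=> z Az; rewrite SE// (bigD1 m)//= dfwithin big1 ?addr0// => l lm.
  by rewrite dfwithout 1?eq_sym// rk_fun0 ?scaler0//; exact: AB.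
split.
  move=> f; exists (fun n => T n f); split; first exact: decomposesT.
  by move=> F fF; exact: decomposes_inj (decomposesT f) fF.
exists T, S; split => //.
- by move=> f F fF n z _; rewrite (decomposes_inj _ _ _ fF (decomposesT f)).
- by move=> n; split; exists 1 => f; rewrite mul1r; [exact: T_le|exact: S_le].
- split=> // [n g|n m g nm]; rewrite TS_delta; first exact: dfwithin.
  by rewrite dfwithout// eq_sym.
Qed.
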